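(* Let $T=\sum_{i=0}^{+\infty}T_i\in\mathrm{Hom}^0(S(\mathfrak h),\mathfrak g)$ be a homotopy $\mathcal O$-operator of weight $1$ on a symmetric graded Lie algebra $(\mathfrak g,[\cdot,\cdot]_{\mathfrak g})$ with respect to an action $\rho:\mathfrak g\to\mathrm{Der}(\mathfrak h)$ on a symmetric graded Lie algebra $(\mathfrak h,[\cdot,\cdot]_{\mathfrak h})$. Then $(\mathfrak h,[\cdot,\cdot]_{\mathfrak h},\{\theta_k\}_{k=1}^\infty)$ is an operator homotopy post-Lie algebra, where $\theta_k:\otimes^k\mathfrak h\to\mathfrak h$ $(k\ge1)$ are the linear maps of degree $1$ defined by $$\theta_k(v_1,\dots,v_k):=\rho\big(T_{k-1}(v_1,\dots,v_{k-1})\big)v_k,\qquad\forall v_1,\dots,v_k\in\mathfrak h.$$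
   Context: All vector spaces are over a field of characteristic zero; graded means $\mathbb Z$-graded. For a homogeneous element $x$, the symbol $x$ in an exponent of $-1$ denotes its degree. For a graded vector space $V$, $S(V)=\oplus_{i\ge0}S^i(V)$ is the (graded-commutative) symmetric algebra with product $\odot$. The Koszul sign $\varepsilon(\sigma)=\varepsilon(\sigma;v_1,\dots,v_n)$ is defined by $v_1\odot\cdots\odot v_n=\varepsilon(\sigma)\,v_{\sigma(1)}\odot\cdots\odot v_{\sigma(n)}$. $\mathbb S_{(i_1,\dots,i_k)}$ is the set of $(i_1,\dots,i_k)$-shuffles, i.e. permutations of $\{1,\dots,i_1+\cdots+i_k\}$ increasing on each of the consecutive blocks of sizes $i_1,\dots,i_k$ (empty if some $i_j<0$). $\mathrm{Hom}^n(S(V),W)$ is the space of degree $n$ linear maps; such $f$ is written $f=\sum_{i\ge0}f_i$ with $f_i:S^i(V)\to W$ ($f_0\in W^n$). In sums over $k+l=p+1$, $k\ge1$ and $l\ge0$. A symmetric graded Lie algebra (sgLa) is a graded vector space $\mathfrak g$ with a bilinear bracket of degree $1$ such that $[x,y]_{\mathfrak g}=(-1)^{xy}[y,x]_{\mathfrak g}$ and $[x,[y,z]_{\mathfrak g}]_{\mathfrak g}=(-1)^{x+1}[[x,y]_{\mathfrak g},z]_{\mathfrak g}+(-1)^{(x+1)(y+1)}[y,[x,z]_{\mathfrak g}]_{\mathfrak g}$. Homomorphisms are degree $0$ bracket-preserving linear maps. A derivation of degree $n$ of a sgLa $\mathfrak h$ is a degree $n$ linear map $D$ with $D[x,y]_{\mathfrak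 h}=(-1)^n[Dx,y]_{\mathfrak h}+(-1)^{n(x+1)}[x,Dy]_{\mathfrak h}$; $\mathrm{Der}(\mathfrak h)=\oplus_n\mathrm{Der}^n(\mathfrak h)$. $(s^{-1}V)^i=V^{i+1}$ is the desuspension, with degree $-1$ identity map $s^{-1}:V\to s^{-1}V$; $s^{-1}\mathrm{Der}(\mathfrak h)$ is a sgLa with $[s^{-1}f,s^{-1}g]:=(-1)^ms^{-1}[f,g]$ for $f$ of degree $m$, $[f,g]$ the graded commutator. An action of $\mathfrak g$ on $\mathfrak h$ is a degree $1$ linear map $\rho:\mathfrak g\to\mathrm{Der}(\mathfrak h)$ such that $s^{-1}\circ\rho$ is a sgLa homomorphism. Homotopy $\mathcal O$-operator of weight $\lambda$ on $\mathfrak g$ with respect to $\rho$ (here $\lambda=1$): a degree $0$ element $T=\sum_{i\ge0}T_i\in\mathrm{Hom}(S(\mathfrak h),\mathfrak g)$, $T_i:S^i(\mathfrak h)\to\mathfrak g$, such that for all $p\ge0$ and homogeneous $v_1,\dots,v_p\in\mathfrak h$ $$\begin{aligned}&\sum_{1\le i<j\le p}(-1)^{v_i(v_1+\cdots+v_{i-1})+v_j(v_1+\cdots+v_{j-1})+v_iv_j}T_{p-1}(\lambda[v_i,v_j]_{\mathfrak h},v_1,\dots,\hat v_i,\dots,\hat v_j,\dots,v_p)\\&+\sum_{k+l=p+1}\sum_{\sigma\in\mathbb S_{(l,1,p-l-1)}}\varepsilon(\sigma)T_{k-1}\Big(\rho\big(T_l(v_{\sigma(1)},\dots,v_{\sigma(l)})\big)v_{\sigma(l+1)},v_{\sigma(l+2)},\dots,v_{\sigma(p)}\Big)\\&=\frac12\sum_{k+l=p+1}\sum_{\sigma\in\mathbb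 S_{(k-1,l)}}\varepsilon(\sigma)[T_{k-1}(v_{\sigma(1)},\dots,v_{\sigma(k-1)}),T_l(v_{\sigma(k)},\dots,v_{\sigma(p)})]_{\mathfrak g}.\end{aligned}$$ An operator homotopy post-Lie algebra is a sgLa $(\mathfrak g,[\cdot,\cdot]_{\mathfrak g})$ with linear maps $\theta_k:\otimes^k\mathfrak g\to\mathfrak g$ ($k\ge1$) of degree $1$ such that for all homogeneous $x_1,\dots,x_{n+1}$ and all $n\ge1$: (i) $\theta_n(x_{\sigma(1)},\dots,x_{\sigma(n-1)},x_n)=\varepsilon(\sigma)\theta_n(x_1,\dots,x_{n-1},x_n)$ for every $\sigma\in\mathbb S_{n-1}$; (ii) $\theta_n(x_1,\dots,x_{n-1},[x_n,x_{n+1}]_{\mathfrak g})=(-1)^{x_1+\cdots+x_{n-1}+1}[\theta_n(x_1,\dots,x_{n-1},x_n),x_{n+1}]_{\mathfrak g}+(-1)^{(x_1+\cdots+x_{n-1}+1)(x_n+1)}[x_n,\theta_n(x_1,\dots,x_{n-1},x_{n+1})]_{\mathfrak g}$; (iii) $$\begin{aligned}&\sum_{i+j=n+1,\ i\ge1,\ j\ge2}\ \sum_{\sigma\in\mathbb S_{(i-1,1,j-2)}}\varepsilon(\sigma)\theta_j(\theta_i(x_{\sigma(1)},\dots,x_{\sigma(i-1)},x_{\sigma(i)}),x_{\sigma(i+1)},\dots,x_{\sigma(n-1)},x_n)\\&+\sum_{i+j=n+1,\ i\ge1,\ j\ge1}\ \sum_{\sigma\in\mathbb S_{(j-1,i-1)}}(-1)^{\alpha}\varepsilon(\sigma)\theta_j(x_{\sigma(1)},\dots,x_{\sigma(j-1)},\theta_i(x_{\sigma(j)},\dots,x_{\sigma(n-1)},x_n))\\&=\sum_{1\le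 i<j\le n-1}(-1)^{\beta}\theta_{n-1}([x_i,x_j]_{\mathfrak g},x_1,\dots,\hat x_i,\dots,\hat x_j,\dots,x_n),\end{aligned}$$ where $\alpha=x_{\sigma(1)}+\cdots+x_{\sigma(j-1)}$ and $\beta=x_i(x_1+\cdots+x_{i-1})+x_j(x_1+\cdots+x_{j-1})+x_ix_j+1$. *)

(* Defs.v *)
From HB Require Import structures.
From mathcomp Require Import all_boot all_order all_algebra all_fingroup.
From mathcomp Require Import generic_quotient ring_quotient.
From mathcomp Require Import boolp.
From mathcomp Require Import finmap monalg.

Set Implicit Arguments.
Unset Strict Implicit.
Unset Printing Implicit Defensive.

Import GRing.Theory.
Local Open Scope ring_scope.

(* A graded vector space is an internal direct sum: [homog i] is the subspace *)
(* V^i of the total space V.                                                  *)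
Record gradedSpace (K : fieldType) := GradedSpace {
  gsort :> lmodType K;
  homog : int -> gsort -> Prop;
  homog0 : forall i, homog i 0;
  homog_lin : forall i (a : K) x y,
    homog i x -> homog i y -> homog i (a *: x + y);
  homog_dec : forall x, exists (s : seq int) (c : int -> gsort),
    (forall i, homog i (c i)) /\ x = \sum_(i <- s) c i;
  homog_indep : forall (s : seq int) (c : int -> gsort), uniq s ->
    (forall i, homog i (c i)) -> \sum_(i <- s) c i = 0 ->
    forall i, i \in s -> c i = 0
}.

Section Sign.
Variable K : fieldType.

Definition sgn (n : int) : K := (-1) ^ n.

Lemma sgn0 : sgn 0 = 1.
Proof. exact: expr0z. Qed.

Lemma sgnD m n : sgn (m + n) = sgn m * sgn n.
Proof. by rewrite /sgn expfzDr // oppr_eq0 oner_eq0. Qed.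

Lemma sgn_sqr n : sgn n * sgn n = 1.
Proof. by rewrite /sgn -expfzMl mulrNN mulr1 exp1rz. Qed.

End Sign.

(* [v_{s(0)}; ...; v_{s(n-1)}] *)
Definition permw (A : Type) n (v : 'I_n -> A) (s : 'S_n) : seq A :=
  [seq v (s i) | i <- enum 'I_n].

Definition word (A : Type) n (v : 'I_n -> A) : seq A :=
  [seq v i | i <- enum 'I_n].

Definition word2 (A : Type) n (v : 'I_n -> A) (i j : 'I_n) : seq A :=
  [seq v k | k <- enum 'I_n & (k != i) && (k != j)].

(* The sign exchanging v_a and v_b is collected for every inversion of s;    *)
(* [sym_koszul] below is the defining relation                                *)
(* v_1 . ... . v_n = eps(s) v_{s(1)} . ... . v_{s(n)} in S(V).                *)
Definition koszul (K : fieldType) n (d : 'I_n -> int) (s : 'S_n) : K :=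
  \prod_(i < n) \prod_(j < n | (i < j)%N && (s j < s i)%N)
     sgn K (d (s i) * d (s j)).

(* [reshape_index bs a] is the number of the block containing position a.     *)
(* The set is empty unless the block sizes add up to n; a block of negative   *)
(* size, truncated to 0 in nat, therefore gives the empty set.                *)
Definition shuffles n (bs : seq nat) : {set 'S_n} :=
  [set s : 'S_n | (sumn bs == n) &&
    [forall a : 'I_n, forall b : 'I_n,
      (a < b)%N && (reshape_index bs a == reshape_index bs b) ==>
      (s a < s b)%N]].

Section Span.
Variables (K : fieldType) (M : lmodType K).

Inductive lspan (R : M -> Prop) : M -> Prop :=
| lspan_nil : lspan R 0
| lspan_cons (a : K) r x of R r & lspan R x : lspan R (a *: r + x).

Lemma lspanD R x y : lspan R x -> lspan R y -> lspan R (x + y).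
Proof.
elim=> [|a r {}x Rr _ IH] Sy; first by rewrite add0r.
by rewrite -addrA; apply: lspan_cons => //; apply: IH.
Qed.

Lemma lspanZ R a x : lspan R x -> lspan R (a *: x).
Proof.
elim=> [|b r {}x Rr _ IH]; first by rewrite scaler0; constructor.
by rewrite scalerDr scalerA; constructor.
Qed.

Lemma lspan_gen (R : M -> Prop) x : R x -> lspan R x.
Proof.
by move=> Rx; rewrite -[x]addr0 -[X in X + _]scale1r; do 2?constructor.
Qed.

End Span.

Section Sym.
Variables (K : fieldType) (V : gradedSpace K).

(* The vector space with basis the words in the elements of V, i.e. the free  *)
(* associative algebra on the set V.                                          *)
Definition wspace : lmodType K := {malg K[seq V]}.
Definition wvec (w : seq V) : wspace := << 1 *g w >>.

(* The two-sided ideal defining S(V) is the span of these relations: letters  *)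
(* are linear (which gives the tensor algebra) and graded-commute.            *)
Inductive symrel : wspace -> Prop :=
| symrel_lin u t a x y :
    symrel (wvec (u ++ (a *: x + y) :: t)
            - (a *: wvec (u ++ x :: t) + wvec (u ++ y :: t)))
| symrel_comm u t i j x y of homog i x & homog j y :
    symrel (wvec (u ++ x :: y :: t) - sgn K (i * j) *: wvec (u ++ y :: x :: t)).

Definition symideal : {pred wspace} := fun x => `[< lspan symrel x >].

Lemma symideal_zmod_closed : zmod_closed symideal.
Proof.
split; first by apply/asboolP; constructor.
move=> x y /asboolP Sx /asboolP Sy; apply/asboolP.
by apply: lspanD => //; rewrite -scaleN1r; apply: lspanZ.
Qed.
HB.instance Definition _ := GRing.isZmodClosed.Build wspace symideal
  symideal_zmod_closed.

Definition sym := Quotient.quot symideal.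
HB.instance Definition _ := GRing.Zmodule.on sym.


Definition sym_pi (x : wspace) : sym := (\pi_sym x)%qT.

Lemma sym_piP x y : (sym_pi x = sym_pi y) <-> lspan symrel (x - y).
Proof.
split=> [e|Sxy].
  by apply/asboolP; rewrite -/(symideal _) -[symideal _]/(_ \in symideal)
    Quotient.idealrBE; apply/eqP.
apply/eqP; rewrite /sym_pi -Quotient.idealrBE.
exact/asboolP.
Qed.

Lemma sym_piK (x : sym) : sym_pi (repr x) = x.
Proof. exact: reprK. Qed.

Lemma sym_piD : {morph sym_pi : x y / x + y}.
Proof. by move=> x y; exact: Quotient.pi_add. Qed.

Definition sym_scale (a : K) (x : sym) : sym := sym_pi (a *: repr x).

Lemma sym_piZ a x : sym_pi (a *: x) = sym_scale a (sym_pi x).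
Proof.
by apply/sym_piP; rewrite -scalerBr; apply/lspanZ/sym_piP; rewrite sym_piK.
Qed.

Fact sym_scaleA a b x : sym_scale a (sym_scale b x) = sym_scale (a * b) x.
Proof. by rewrite -[x]sym_piK -!sym_piZ scalerA. Qed.
Fact sym_scale1 : left_id 1 sym_scale.
Proof. by move=> x; rewrite -[x]sym_piK -!sym_piZ scale1r. Qed.
Fact sym_scaleDr : right_distributive sym_scale +%R.
Proof.
move=> a x y; rewrite -[x]sym_piK -[y]sym_piK.
by rewrite -!sym_piZ -!sym_piD -sym_piZ scalerDr.
Qed.
Fact sym_scaleDl x : {morph sym_scale^~ x : a b / a + b}.
Proof.
by move=> a b; rewrite -[x]sym_piK -!sym_piZ -sym_piD scalerDl.
Qed.
HB.instance Definition _ := GRing.Zmodule_isLmodule.Build K sym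
  sym_scaleA sym_scale1 sym_scaleDr sym_scaleDl.

(* [symw [:: v_1; ...; v_n]] is the product of v_1, ..., v_n in S(V), an      *)
(* element of S^n(V); S^n(V) is the span of these products.                   *)
Definition symw (w : seq V) : sym := sym_pi (wvec w).

Lemma symw_lin u t a x y :
  symw (u ++ (a *: x + y) :: t) = a *: symw (u ++ x :: t) + symw (u ++ y :: t).
Proof.
transitivity (sym_pi (a *: wvec (u ++ x :: t) + wvec (u ++ y :: t))).
  by apply/sym_piP/lspan_gen; apply: symrel_lin.
by rewrite sym_piD sym_piZ.
Qed.

Lemma symw_comm u t i j x y : homog i x -> homog j y ->
  symw (u ++ x :: y :: t) = sgn K (i * j) *: symw (u ++ y :: x :: t).
Proof.
move=> hx hy; rewrite -[RHS]sym_piZ.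
by apply/sym_piP/lspan_gen; apply: symrel_comm hx hy.
Qed.

Definition symhomog (m : int) : sym -> Prop :=
  lspan (fun z => exists n (v : 'I_n -> V) (d : 'I_n -> int),
    [/\ forall i, homog (d i) (v i), m = \sum_i d i & z = symw (word v)]).

Section Koszul.
Variables (n : nat) (v : 'I_n -> V) (d : 'I_n -> int).
Hypothesis hv : forall i, homog (d i) (v i).

Let c (x : 'I_n) (L : seq 'I_n) : K :=
  \prod_(y <- L | (y < x)%N) sgn K (d x * d y).

Fixpoint invsgn (L : seq 'I_n) : K := if L is x :: L' then c x L' * invsgn L' else 1.

Fixpoint ins (x : 'I_n) (S : seq 'I_n) :=
  if S is y :: S' then if (y < x)%N then y :: ins x S' else x :: S else [:: x].

Fixpoint isort (L : seq 'I_n) := if L is x :: L' then ins x (isort L') else [::].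

Let le : rel 'I_n := fun a b => (a <= b)%N.

Lemma perm_ins x S : perm_eq (ins x S) (x :: S).
Proof.
elim: S => //= y S IH; case: ifP => // _.
by rewrite -(perm_cons y) in IH; apply: (perm_trans IH); rewrite (perm_catCA [:: y] [:: x]).
Qed.

Lemma perm_isort L : perm_eq (isort L) L.
Proof.
by elim: L => //= x L IH; apply: (perm_trans (perm_ins _ _)); rewrite perm_cons.
Qed.

Lemma path_ins x S z : path le z S -> le z x -> path le z (ins x S).
Proof.
elim: S z => [|y S IH] z //=; first by move=> _ ->.
move=> /andP[zy pS] zx; case: ltnP => yx /=; first by rewrite zy IH // /le ltnW.
by rewrite zx /= pS /le yx.
Qed.

Lemma sorted_ins x S : sorted le S -> sorted le (ins x S).
Proof.
case: S => //= y S pS; case: ltnP => yx /=; first by rewrite path_ins // /le ltnW.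
by rewrite /le yx.
Qed.

Lemma sorted_isort L : sorted le (isort L).
Proof. by elim: L => //= x L; exact: sorted_ins. Qed.

Let le_tr : transitive le. Proof. by move=> a b e; exact: leq_trans. Qed.

Lemma symw_ins u x S : sorted le S ->
  symw (u ++ map v (ins x S)) = c x S *: symw (u ++ v x :: map v S).
Proof.
elim: S u => [|y S IH] u /=; first by rewrite /c big_nil scale1r.
move=> pS; rewrite /c big_cons; case: ltnP => yx /=.
  rewrite -cat_rcons IH ?(path_sorted pS) // cat_rcons.
  rewrite (symw_comm _ _ (hv y) (hv x)) scalerA mulrC.
  by rewrite [(d y * _)%R]mulrC.
rewrite big_seq_cond big_pred0 ?scale1r // => z.
apply/negbTE; rewrite negb_and -leqNgt -implybE; apply/implyP => zS.
apply: leq_trans yx _.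
by have /allP/(_ _ zS) := order_path_min le_tr pS.
Qed.

Lemma symw_isort u L :
  symw (u ++ map v (isort L)) = invsgn L *: symw (u ++ map v L).
Proof.
elim: L u => [|x L IH] u /=; first by rewrite scale1r.
rewrite symw_ins ?sorted_isort // -cat_rcons IH cat_rcons scalerA.
by congr (_ * _ *: _); rewrite /c; apply: perm_big; exact: perm_isort.
Qed.

Lemma inv_map m (f : 'I_m -> 'I_n) : invsgn [seq f i | i <- enum 'I_m] =
  \prod_(i < m) \prod_(j < m | (i < j)%N && (f j < f i)%N)
     sgn K (d (f i) * d (f j)).
Proof.
elim: m f => [|m IH] f; first by rewrite enum_ord0 big_ord0.
rewrite enum_ordSl /= -map_comp IH big_ord_recl; congr (_ * _).
  rewrite /c big_map big_enum_cond big_mkcond [RHS]big_mkcond big_ord_recl /=.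
  by rewrite mul1r.
apply: eq_bigr => i _; rewrite [RHS]big_mkcond big_ord_recl /= mul1r.
by rewrite big_mkcond.
Qed.

Lemma sym_koszul (s : 'S_n) :
  symw (word v) = koszul K d s *: symw (permw v s).
Proof.
have := symw_isort [::] [seq s i | i <- enum 'I_n].
rewrite inv_map -[map v (map _ _)]map_comp !cat0s => E.
apply: etrans E; congr (symw (map v _)).
have anti : antisymmetric le by move=> a b; rewrite /le -eqn_leq => /eqP/val_inj.
apply: (sorted_eq le_tr anti).
- by by have := iota_sorted 0 n; rewrite -val_enum_ord sorted_map.
- exact: sorted_isort.
rewrite perm_sym; apply: (perm_trans (perm_isort _)).
apply: uniq_perm; rewrite ?enum_uniq //.
  by rewrite (map_inj_uniq (@perm_inj _ s)) enum_uniq.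
move=> i; rewrite mem_enum [RHS]inE; apply/mapP; exists (s^-1%g i); rewrite ?mem_enum //.
by rewrite permKV.
Qed.

End Koszul.
End Sym.

Section Structures.
Variable K : fieldType.

Definition is_hom (V W : gradedSpace K) (n : int) (f : V -> W) : Prop :=
  linear f /\ forall i x, homog i x -> homog (i + n) (f x).

Record sgLa := SgLa {
  sgspace :> gradedSpace K;
  br : sgspace -> sgspace -> sgspace;
  br_linr : forall x, linear (br x);
  br_linl : forall y, linear (br^~ y);
  br_deg : forall i j x y, homog i x -> homog j y -> homog (i + j + 1) (br x y);
  br_sym : forall i j x y, homog i x -> homog j y ->
    br x y = sgn K (i * j) *: br y x;
  br_jacobi : forall i j k x y z, homog i x -> homog j y -> homog k z ->
    br x (br y z) = sgn K (i + 1) *: br (br x y) z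
                    + sgn K ((i + 1) * (j + 1)) *: br y (br x z)
}.

(* D belongs to Der^n(h) *)
Definition is_der (h : sgLa) (n : int) (D : h -> h) : Prop :=
  is_hom n D /\
  forall i j x y, homog i x -> homog j y ->
    D (br x y) = sgn K n *: br (D x) y + sgn K (n * (i + 1)) *: br x (D y).

(* for f, g of degrees m, n *)
Definition gcomm (V : gradedSpace K) (m n : int) (f g : V -> V) : V -> V :=
  fun v => f (g v) - sgn K (m * n) *: g (f v).

(* The bracket of s^-1 Der(h), for derivations f, g of degrees m, n:          *)
(* [s^-1 f, s^-1 g] = s^-1 (sder_br m n f g).                                 *)
Definition sder_br (V : gradedSpace K) (m n : int) (f g : V -> V) : V -> V :=
  fun v => sgn K m *: gcomm m n f g v.

(* rho is linear of degree 1 with values in Der(h), and s^-1 o rho, which has *)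
(* degree 0, preserves brackets; for x in g^i, rho x has degree i + 1.        *)
Record sgLa_action (g h : sgLa) (rho : g -> h -> h) : Prop := IsAction {
  act_lin : forall (a : K) x y v, rho (a *: x + y) v = a *: rho x v + rho y v;
  act_der : forall i x, homog i x -> is_der (i + 1) (rho x);
  act_br : forall i j x y v, homog i x -> homog j y ->
    rho (br x y) v = sder_br (i + 1) (j + 1) (rho x) (rho y) v
}.

(* f in Hom^n(S(V), W) *)
Definition sym_hom (V W : gradedSpace K) (n : int) (f : sym V -> W) : Prop :=
  linear f /\ forall m z, symhomog m z -> homog (m + n) (f z).

(* T_i (v_1, ..., v_i), for w = [:: v_1; ...; v_i], is the value of T at the  *)
(* product of the v's, which lies in S^i(V); [hcomp] is used below with       *)
(* size w = i only.                                                           *)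
Definition hcomp (V W : gradedSpace K) (T : sym V -> W) (i : nat) (w : seq V) : W :=
  T (symw w).

(* exponent of the sign extracting v_i, v_j (i < j) to the front *)
Definition front_exp p (d : 'I_p -> int) (i j : 'I_p) : int :=
  d i * (\sum_(a < p | (a < i)%N) d a) + d j * (\sum_(a < p | (a < j)%N) d a)
  + d i * d j.

Definition homotopy_O_operator (lambda : K) (g h : sgLa) (rho : g -> h -> h)
    (T : sym h -> g) : Prop :=
  sym_hom 0 T /\
  forall (p : nat) (v : 'I_p -> h) (d : 'I_p -> int),
    (forall i, homog (d i) (v i)) ->
    \sum_(i < p) \sum_(j < p | (i < j)%N)
       sgn K (front_exp d i j) *:
         hcomp T p.-1 (lambda *: br (v i) (v j) :: word2 v i j)
  + \sum_(1 <= k < p.+2) \sum_(0 <= l < p.+2 | (k + l == p.+1)%N)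
      \sum_(s in shuffles p [:: l; 1; p - l - 1]%N)
        koszul K d s *:
          (let w := permw v s in
           hcomp T k.-1
             (rho (hcomp T l (take l w)) (nth 0 w l) :: drop l.+1 w))
  = 2^-1 *:
    \sum_(1 <= k < p.+2) \sum_(0 <= l < p.+2 | (k + l == p.+1)%N)
      \sum_(s in shuffles p [:: k.-1; l])
        koszul K d s *:
          (let w := permw v s in
           br (hcomp T k.-1 (take k.-1 w)) (hcomp T l (drop k.-1 w))).

(* A family of linear maps theta_k : V^{(x) k} -> V (k >= 1) is a family of   *)
(* multilinear maps; [theta k] is evaluated only at sequences of size k >= 1. *)
Definition multilin (V : gradedSpace K) (theta : nat -> seq V -> V) : Prop :=
  forall u t a x y,
    let k := (size u + size t).+1 in
    theta k (u ++ (a *: x + y) :: t)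
    = a *: theta k (u ++ x :: t) + theta k (u ++ y :: t).

Definition multideg1 (V : gradedSpace K) (theta : nat -> seq V -> V) : Prop :=
  forall (k : nat) (x : 'I_k -> V) (d : 'I_k -> int), (0 < k)%N ->
    (forall i, homog (d i) (x i)) ->
    homog (\sum_i d i + 1) (theta k (word x)).

(* In the three axioms n = m + 1; x_1, ..., x_m are given by x : 'I_m -> g,   *)
(* of degrees d, and the remaining arguments separately.                      *)
Definition post_Lie_symm (g : sgLa) (theta : nat -> seq g -> g) : Prop :=
  forall (m : nat) (x : 'I_m -> g) (d : 'I_m -> int) (e : int) (y : g),
    (forall i, homog (d i) (x i)) -> homog e y ->
    forall s : 'S_m,
      theta m.+1 (rcons (permw x s) y)
      = koszul K d s *: theta m.+1 (rcons (word x) y).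

Definition post_Lie_der (g : sgLa) (theta : nat -> seq g -> g) : Prop :=
  forall (m : nat) (x : 'I_m -> g) (d : 'I_m -> int) (e f : int) (y z : g),
    (forall i, homog (d i) (x i)) -> homog e y -> homog f z ->
    theta m.+1 (rcons (word x) (br y z))
    = sgn K (\sum_i d i + 1) *: br (theta m.+1 (rcons (word x) y)) z
      + sgn K ((\sum_i d i + 1) * (e + 1)) *:
          br y (theta m.+1 (rcons (word x) z)).

Definition post_Lie_rel (g : sgLa) (theta : nat -> seq g -> g) : Prop :=
  forall (m : nat) (x : 'I_m -> g) (d : 'I_m -> int) (e : int) (y : g),
    (forall i, homog (d i) (x i)) -> homog e y ->
    let n := m.+1 in
    \sum_(1 <= i < n.+1) \sum_(2 <= j < n.+1 | (i + j == n.+1)%N)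
      \sum_(s in shuffles m [:: i.-1; 1; j - 2]%N)
        koszul K d s *:
          (let w := rcons (permw x s) y in
           theta j (theta i (take i w) :: drop i w))
  + \sum_(1 <= i < n.+1) \sum_(1 <= j < n.+1 | (i + j == n.+1)%N)
      \sum_(s in shuffles m [:: j.-1; i.-1])
        (sgn K (\sum_(a < m | (a < j.-1)%N) d (s a)) * koszul K d s) *:
          (let w := rcons (permw x s) y in
           theta j (rcons (take j.-1 w) (theta i (drop j.-1 w))))
  = \sum_(i < m) \sum_(j < m | (i < j)%N)
      sgn K (front_exp d i j + 1) *:
        theta n.-1 (br (x i) (x j) :: rcons (word2 x i j) y).

Record operator_homotopy_post_Lie (g : sgLa) (theta : nat -> seq g -> g) : Prop :=
  OperatorHomotopyPostLie {
    ohpl_multilin : multilin theta;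
    ohpl_deg : multideg1 theta;
    ohpl_symm : post_Lie_symm theta;
    ohpl_der : post_Lie_der theta;
    ohpl_rel : post_Lie_rel theta
  }.

Definition theta_of (g h : sgLa) (rho : g -> h -> h) (T : sym h -> g)
    (k : nat) (w : seq h) : h :=
  rho (hcomp T k.-1 (take k.-1 w)) (nth 0 w k.-1).

End Structures.

(* Main.v *)
From HB Require Import structures.
Require Import Defs.
From mathcomp Require Import all_boot all_order all_algebra all_fingroup.
From mathcomp Require Import zify ring.

Set Implicit Arguments.
Unset Strict Implicit.
Unset Printing Implicit Defensive.

Import GRing.Theory.
Local Open Scope ring_scope.

(** The axioms other than the quadratic relation only repeat properties of the
    data: multilinearity and symmetry in the first arguments are those of a
    function on S(h), and the degree and the derivation rule in the last
    argument hold because [rho] takes its values in the derivations of h.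

    The quadratic relation, with last letter y, is the image of the O-operator
    identity at the other letters under the linear map x |-> rho x y.  The terms
    T([x_i, x_j], ...) become minus the right-hand side, and the terms
    T(rho(T(...)) x, ...) become the first sum of the relation.  There is one
    term [T(u), T(v)] for each way of splitting the letters into two increasing
    subwords u and v.  As [rho] carries brackets to commutators, such a term
    becomes, up to signs, rho(T(u)) rho(T(v)) y plus rho(T(v)) rho(T(u)) y.
    Exchanging u and v is a bijection on the splittings ([rotp_shuffle]), and
    its effect on the Koszul sign ([invsgn_swap]) is what turns the sign of the
    second kind of term into that of the first kind ([act_br_nested]).  So both
    kinds have the same sum ([sum_shuffle_swap]), which is minus the second sum
    of the relation, and the factor 1/2 of the O-operator identity accounts for
    there being two of them. *)

(** * Words, signs and sums along an antidiagonal *)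

Lemma take_rcons {A : Type} k (w : seq A) z : (k <= size w)%N ->
  take k (rcons w z) = take k w.
Proof. by move=> kw; rewrite -cats1 takel_cat. Qed.

Lemma size_word {A : Type} {n} (v : 'I_n -> A) : size (word v) = n.
Proof. by rewrite size_map size_enum_ord. Qed.

Lemma size_permw {A : Type} {n} (v : 'I_n -> A) s : size (permw v s) = n.
Proof. by rewrite size_map size_enum_ord. Qed.

Lemma size_word2 {A : Type} n (v : 'I_n -> A) i j : i != j ->
  (size (word2 v i j)).+2 = n.
Proof.
move=> ij; rewrite size_map size_filter.
rewrite -[RHS]card_ord -(cardC (pred2 i j)) card2 ij; congr _.+2.
rewrite cardE size_filter enumT; apply: eq_count => k.
by rewrite !inE negb_or.
Qed.

Lemma sgn1 (K : fieldType) : sgn K 1 = -1.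
Proof. by []. Qed.

Lemma koszul_sqr (K : fieldType) n (d : 'I_n -> int) s : koszul K d s * koszul K d s = 1.
Proof.
rewrite /koszul -big_split /= big1 // => i _.
by rewrite -big_split /= big1 // => j _; rewrite sgn_sqr.
Qed.

(** The sums over k + l constant are given as double sums over rectangles which
    contain, and exceed, the antidiagonal. *)
Lemma sum_diag {M : nmodType} (p q m N : nat) (F : nat -> nat -> M) :
  (p + m < N)%N -> (q + m < N)%N ->
  \sum_(p <= i < N) \sum_(q <= j < N | (i + j == p + q + m)%N) F i j
  = \sum_(a < m.+1) F (p + a)%N (q + (m - a))%N.
Proof.
move=> pN qN.
rewrite (big_cat_nat (n := p + m.+1)) /=; [|lia|lia].
rewrite [X in _ + X]big_nat_cond [X in _ + X]big1 ?addr0; last first.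
  move=> i; rewrite andbT => /andP[hi _].
  by rewrite big_nat_cond big1 // => j; lia.
rewrite -{1}[p]add0n big_addn (_ : (p + m.+1 - p)%N = m.+1); last lia.
rewrite big_mkord; apply: eq_bigr => a _.
have am : (a < m.+1)%N := ltn_ord a.
rewrite (big_cat_nat (n := q + (m - a))) /=; [|lia|lia].
rewrite big_nat_cond big1 ?add0r; last by move=> j; lia.
rewrite big_ltn_cond; last lia.
rewrite ifT; last lia.
rewrite big_nat_cond big1 ?addr0 ?(addnC a) // => j; lia.
Qed.

(** * Koszul signs of words of indices *)

Section KoszulWords.
Variables (K : fieldType) (n : nat) (d : 'I_n -> int).
Implicit Types L : seq 'I_n.

Definition wdeg L : int := \sum_(x <- L) d x.

(** The signs of the inversions whose larger index is in L1 and whose smaller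
    index is in L2, that is, of those across the two blocks of L1 ++ L2. *)
Let cross L1 L2 : K :=
  \prod_(x <- L1) \prod_(y <- L2 | (y < x)%N) sgn K (d x * d y).

Lemma invsgn_cat L1 L2 :
  invsgn K d (L1 ++ L2) = invsgn K d L1 * invsgn K d L2 * cross L1 L2.
Proof.
rewrite /cross; elim: L1 => [|x L1 IH] /=; first by rewrite big_nil mul1r mulr1.
by rewrite IH big_cons big_cat /=; ring.
Qed.

Lemma sgn_sum (I : Type) (r : seq I) (P : pred I) (F : I -> int) :
  sgn K (\sum_(i <- r | P i) F i) = \prod_(i <- r | P i) sgn K (F i).
Proof. by rewrite (big_morph _ (@sgnD K) (@sgn0 K)). Qed.

(** Each pair of letters from L1 and L2 is an inversion in exactly one of the two
    concatenations. *)
Lemma cross_swap L1 L2 : uniq (L1 ++ L2) ->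
  cross L1 L2 * cross L2 L1 = sgn K (wdeg L1 * wdeg L2).
Proof.
rewrite cat_uniq => /and3P[_ /hasPn dis _].
rewrite /wdeg mulr_suml sgn_sum /cross [X in _ * X](exchange_big_dep predT) //=.
rewrite -big_split /= [LHS]big_seq [RHS]big_seq; apply: eq_bigr => x xL.
rewrite mulr_sumr sgn_sum [RHS](bigID (fun y : 'I_n => (y < x)%N)) /=.
congr (_ * _); rewrite [LHS]big_seq_cond [RHS]big_seq_cond.
apply: congr_big => //.
  move=> y; case yL: (y \in L2) => //=.
  have yx : (x : nat) != y by apply: contraNneq (dis y yL) => /val_inj <-.
  by rewrite -leqNgt ltn_neqAle yx.
by move=> y _; rewrite mulrC.
Qed.

(** Inversions inside a block are not affected by exchanging the blocks, and the
    pairs across the blocks contribute all of the sign, by [cross_swap]. *)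
Lemma invsgn_swap L1 L2 : uniq (L1 ++ L2) ->
  invsgn K d (L2 ++ L1) = sgn K (wdeg L1 * wdeg L2) * invsgn K d (L1 ++ L2).
Proof.
move=> U; rewrite !invsgn_cat -cross_swap //.
have sq : cross L1 L2 * cross L1 L2 = 1.
  rewrite /cross -big_split /= big1 // => x _.
  by rewrite -big_split /= big1 // => y _; rewrite sgn_sqr.
by rewrite -[LHS]mul1r -sq; ring.
Qed.

Lemma wdeg_enum : wdeg (enum 'I_n) = \sum_i d i.
Proof. by rewrite /wdeg big_enum. Qed.

End KoszulWords.

(** * Cyclic rotation of shuffles *)

Section Rotation.
Variable n : nat.
Implicit Types (s : 'S_n) (a b : nat).

(** The one-line notation of s; a shuffle is handled through this word because
    its blocks are then [take] and [drop]. *)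
Definition pword s : seq 'I_n := [seq s i | i <- enum 'I_n].

(** Composing with [rotp a] rotates the one-line notation by a places, that is,
    exchanges its first a letters with the others ([pword_rotp]); as a left
    translation of 'S_n it is a bijection that can be used to reindex sums. *)
Definition rotp a : 'S_n := (perm (@ordS_inj n) ^+ a)%g.

Lemma size_pword s : size (pword s) = n.
Proof. by rewrite size_map size_enum_ord. Qed.

Lemma pword_uniq s : uniq (pword s).
Proof. by rewrite map_inj_uniq ?enum_uniq //; exact: perm_inj. Qed.

Lemma permw_pword {A : Type} (v : 'I_n -> A) s : permw v s = map v (pword s).
Proof. exact: map_comp. Qed.

Lemma koszul_pword (K : fieldType) (d : 'I_n -> int) s :
  koszul K d s = invsgn K d (pword s).
Proof. by rewrite inv_map. Qed.

Lemma rotpE a (i : 'I_n) : rotp a i = ((i + a) %% n)%N :> nat.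
Proof.
elim: a i => [|a IH] i; first by rewrite /rotp expg0 perm1 addn0 modn_small.
rewrite /rotp expgSr permM permE /= -/(rotp a) IH.
by rewrite addnS -[in LHS]addn1 modnDml addn1.
Qed.

Lemma rotpK a b s : (a + b = n)%N -> (rotp b * (rotp a * s) = s)%g.
Proof.
move=> ab; rewrite mulgA (_ : (rotp b * rotp a)%g = 1%g) ?mul1g //.
apply/permP => i; apply: val_inj; rewrite permM perm1 /= !rotpE.
by rewrite modnDml -addnA [(b + a)%N]addnC ab modnDr modn_small.
Qed.

Lemma rotp_enum a : (a <= n)%N ->
  [seq rotp a i | i <- enum 'I_n] = rot a (enum 'I_n).
Proof.
move=> an; apply: (inj_map val_inj); rewrite map_rot val_enum_ord -map_comp.
rewrite (eq_map (g := (fun j => (j + a) %% n)%N \o val)); last exact: rotpE.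
rewrite map_comp val_enum_ord.
apply: (@eq_from_nth _ 0%N); rewrite size_map ?size_rot // size_iota => i ilt.
rewrite (nth_map 0%N) ?size_iota // nth_iota // /rot nth_cat size_drop size_iota.
rewrite nth_drop add0n.
case: ltnP => h.
  by rewrite nth_iota ?modn_small; lia.
rewrite nth_take; last lia.
rewrite nth_iota; last lia.
rewrite (_ : (i + a = (i - (n - a)) + n)%N); last lia.
by rewrite modnDr modn_small; lia.
Qed.

Lemma pword_rotp a s : (a <= n)%N -> pword (rotp a * s) = rot a (pword s).
Proof.
move=> an; rewrite /pword -map_rot -rotp_enum // -[RHS]map_comp.
by apply: eq_map => i /=; rewrite permM.
Qed.

Lemma reshape_index2 a b (i : nat) : (i < a + b)%N ->
  reshape_index [:: a; b] i = (a <= i)%N.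
Proof.
rewrite /reshape_index /= => h.
by rewrite -subnDA !subn_eq0 h; case: ltnP.
Qed.

(** The rotation moves each block as a whole, so that both blocks remain
    increasing. *)
Lemma rotp_shuffle a b s : (a + b = n)%N ->
  ((rotp a * s)%g \in shuffles n [:: b; a]) = (s \in shuffles n [:: a; b]).
Proof.
move=> ab.
(* By [rotpK] the converse is the same claim for the sizes exchanged. *)
suff H c e t : (c + e = n)%N -> t \in shuffles n [:: c; e] ->
    (rotp c * t)%g \in shuffles n [:: e; c].
  apply/idP/idP; last exact: H.
  by move/H; rewrite rotpK // => -> //; rewrite addnC.
move=> ce; rewrite !inE /= !addn0 (addnC e) ce eqxx /=.
move=> /forallP Ht; apply/forallP => x; apply/forallP => y; apply/implyP.
have xn := ltn_ord x; have yn := ltn_ord y.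
rewrite !reshape_index2; try lia.
move=> /andP[xy blk]; rewrite !permM.
have /forallP/(_ (rotp c y))/implyP := Ht (rotp c x); apply.
(* The first e positions move into the second block of t, the others into the
   first one. *)
have rE (z : 'I_n) : rotp c z = (if (z < e)%N then (z + c)%N else (z - e)%N) :> nat.
  have zn := ltn_ord z; rewrite rotpE; case: ltnP => h; first by rewrite modn_small; lia.
  rewrite (_ : (z + c = z - e + n)%N); last lia.
  by rewrite modnDr modn_small; lia.
rewrite !reshape_index2 ?rE; by move: blk; case: (ltnP x); case: (ltnP y); lia.
Qed.

End Rotation.

Lemma wdeg_take {n} (d : 'I_n -> int) (s : 'S_n) a : (a <= n)%N ->
  \sum_(i < n | (i < a)%N) d (s i) = wdeg d (take a (pword s)).
Proof.
move=> an; have E : take a (enum 'I_n) = [seq i : 'I_n <- enum 'I_n | (i < a)%N].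
  apply: (inj_map val_inj); rewrite map_take -(filter_map val (fun i => i < a)%N).
  rewrite val_enum_ord take_iota (minn_idPl an).
  by rewrite (filter_iota_ltn 0 an).
by rewrite /wdeg /pword -map_take big_map E big_filter big_enum_cond.
Qed.

(** The exchange of blocks as a symmetry of the set of all splittings of n letters
    into two increasing subwords, of any sizes. *)
Lemma sum_shuffle_swap {M : nmodType} n (G : nat -> 'S_n -> M) :
  \sum_(a < n.+1) \sum_(s in shuffles n [:: val a; n - a]%N)
     G (n - a)%N (rotp n a * s)%g
  = \sum_(a < n.+1) \sum_(s in shuffles n [:: val a; n - a]%N) G a s.
Proof.
rewrite [RHS](reindex_inj rev_ord_inj); apply: eq_bigr => a _ /=.
have an : (a <= n)%N by rewrite -ltnS.
rewrite subSS subKn // [RHS](reindex_inj (mulgI (rotp n a))).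
by apply: eq_bigl => s; rewrite rotp_shuffle // subnKC.
Qed.

(** * Actions *)

Section Action.
Variables (K : fieldType) (g h : sgLa K) (rho : g -> h -> h).
Hypothesis rho_action : sgLa_action rho.

Lemma act_linl y : linear (rho^~ y).
Proof. by move=> a x z; exact: act_lin. Qed.

Lemma act0 y : rho 0 y = 0.
Proof.
have := act_linl y 1 0 0; rewrite !scale1r addr0 => /esym/eqP.
by rewrite -subr_eq0 addrK => /eqP.
Qed.

Lemma act_scale a x y : rho (a *: x) y = a *: rho x y.
Proof. by have := act_linl y a x 0; rewrite act0 !addr0. Qed.

(** Linearity in the second argument is given for homogeneous x only, as part of
    the notion of derivation; it extends to all x by decomposing x. *)
Lemma act_linr x : linear (rho x).
Proof.
have [s [c [hc ->]]] := homog_dec x.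
elim: s => [|i s IH] a y z; first by rewrite !big_nil !act0 scaler0 addr0.
rewrite !big_cons -[c i]scale1r !(act_lin rho_action) !scale1r IH.
by rewrite (act_der rho_action (hc i)).1.1 scalerDr addrACA.
Qed.

(** The action law with the desuspension signs multiplied out. *)
Lemma act_brE {i j x z} y : homog i x -> homog j z ->
  rho (br x z) y = - (sgn K i *: rho x (rho z y))
                   - sgn K (i * j + j) *: rho z (rho x y).
Proof.
move=> hx hz; rewrite (act_br rho_action _ hx hz) /sder_br /gcomm.
rewrite scalerBr scalerA -sgnD.
rewrite sgnD sgn1 mulrN1 scaleNr; congr (_ - _ *: _).
(* The exponents differ by twice i + 1. *)
have -> : i + 1 + (i + 1) * (j + 1) = i * j + j + ((i + 1) + (i + 1)) by ring.
by rewrite sgnD [sgn K (i + 1 + _)]sgnD sgn_sqr mulr1.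
Qed.

Lemma act_linear y : exists f : {linear g -> h}, forall z, f z = rho z y.
Proof.
by exists (HB.pack_for {linear g -> h} (rho^~ y)
  (GRing.isLinear.Build K _ _ _ (rho^~ y) (act_linl y))).
Qed.

End Action.

Lemma symw_homog {K : fieldType} {V : gradedSpace K} {n} {v : 'I_n -> V} {d}
    (hv : forall i, homog (d i) (v i)) (L : seq 'I_n) :
  symhomog (wdeg d L) (symw (map v L)).
Proof.
apply: lspan_gen; exists (size L), (v \o tnth (in_tuple L)), (d \o tnth (in_tuple L)).
split=> [i||]; [exact: hv | by rewrite /wdeg big_tnth |].
congr symw; rewrite -[LHS](congr1 (map v) (map_tnth_enum (in_tuple L))).
by rewrite -[LHS]map_comp.
Qed.

(** * The post-Lie operations *)

Section PostLie.
Variables (K : fieldType) (g h : sgLa K) (rho : g -> h -> h).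
Variable T : sym h -> g.
Hypothesis rho_action : sgLa_action rho.
Hypothesis T_hom : sym_hom 0 T.

Local Notation theta := (theta_of rho T).

Lemma theta_rcons k w y : k = (size w).+1 -> theta k (rcons w y) = rho (T (symw w)) y.
Proof. by move=> ->; rewrite /theta_of /= -cats1 take_size_cat // nth_cat ltnn subnn. Qed.

Lemma T_homog {n} {v : 'I_n -> h} {d} (hv : forall i, homog (d i) (v i)) L :
  homog (wdeg d L) (T (symw (map v L))).
Proof. by have := T_hom.2 _ _ (symw_homog hv L); rewrite addr0. Qed.

Lemma theta_multilin : multilin theta.
Proof.
move=> u t a x y /=; case/lastP: t => [|t z].
  rewrite !cats1 !theta_rcons ?addn0 //; exact: act_linr.
rewrite -!rcons_cons -!rcons_cat !theta_rcons; try by rewrite size_cat /= size_rcons; lia.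
by rewrite symw_lin T_hom.1 (act_lin rho_action).
Qed.

Lemma theta_deg1 : multideg1 theta.
Proof.
move=> [//|k] x d _ hx.
have -> : word x = rcons (word (x \o widen_ord (leqnSn k))) (x ord_max).
  by rewrite /word enum_ordSr map_rcons -map_comp.
rewrite theta_rcons ?size_word // big_ord_recr /= [_ + d _]addrC -addrA.
have hx' i : homog ((d \o widen_ord (leqnSn k)) i) ((x \o widen_ord (leqnSn k)) i).
  exact: hx.
have := T_homog hx' (enum 'I_k); rewrite wdeg_enum => hT.
exact: (act_der rho_action hT).1.2.
Qed.

Lemma T_scale a z : T (a *: z) = a *: T z.
Proof.
pose f : {linear sym h -> g} := HB.pack T (GRing.isLinear.Build K _ _ _ T T_hom.1).
exact: (linearZ_LR f).
Qed.

Lemma theta_symm : post_Lie_symm theta.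
Proof.
move=> m x d e y hx _ s.
rewrite !theta_rcons ?size_word ?size_permw // (sym_koszul hx s) T_scale.
by rewrite act_scale // scalerA koszul_sqr scale1r.
Qed.

Lemma theta_der : post_Lie_der theta.
Proof.
move=> m x d e f y z hx hy hz; rewrite !theta_rcons ?size_word //.
have := T_homog hx (enum 'I_m); rewrite wdeg_enum => hT.
exact: (act_der rho_action hT).2 hy hz.
Qed.

Section Relation.
Variables (m : nat) (x : 'I_m -> h) (d : 'I_m -> int) (y : h).
Hypothesis hx : forall i, homog (d i) (x i).

Let TT L := T (symw (map x L)).

(** The terms of the second sum of the quadratic relation. *)
Definition nested a s := (sgn K (wdeg d (take a (pword s))) * koszul K d s) *:
  rho (TT (take a (pword s))) (rho (TT (drop a (pword s))) y).

(** The commutator splits a bracket term into two nested terms; the second one has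
    its two blocks exchanged, and the Koszul sign of the exchange cancels the
    mixed part of the commutator sign. *)
Lemma act_br_nested a s : (a <= m)%N ->
  koszul K d s *: rho (br (TT (take a (pword s))) (TT (drop a (pword s)))) y
  = - nested a s - nested (m - a) (rotp m a * s).
Proof.
move=> am.
rewrite (act_brE rho_action y (T_homog hx _) (T_homog hx _)).
rewrite /nested koszul_pword [koszul K d (_ * _)%g]koszul_pword pword_rotp //.
have sz : size (drop a (pword s)) = (m - a)%N by rewrite size_drop size_pword.
have -> : take (m - a) (rot a (pword s)) = drop a (pword s) by rewrite take_size_cat.
have -> : drop (m - a) (rot a (pword s)) = take a (pword s) by rewrite drop_size_cat.
rewrite /rot invsgn_swap ?cat_take_drop ?pword_uniq //.
rewrite scalerBr scalerN !scalerA [X in X *: _]mulrC; congr (_ - _ *: _).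
by rewrite sgnD; ring.
Qed.

End Relation.

(** This is the image of the O-operator identity under the action on y.  In the
    proof A, B and C are the three sums of that identity; f A is minus the
    right-hand side R of the relation, f B is its first sum S1, and f C is minus
    twice its second sum S2. *)
Lemma theta_rel : [pchar K] =i pred0 -> homotopy_O_operator 1 rho T ->
  post_Lie_rel theta.
Proof.
move=> char0 TO m x d e y hx _ n; rewrite /n => {n}.
have [f fE] := act_linear rho_action y.
have fZ a z : f (a *: z) = a *: f z by exact: linearZ_LR.
have := congr1 f (TO.2 m x d hx).
set A := (X in f (X + _)); set B := (X in f (_ + X)); set C := (X in f (_ *: X)).
set S1 := (X in _ -> X + _ = _); set S2 := (X in _ -> _ + X = _).
set R := (X in _ -> _ = X).
pose D := \sum_(a < m.+1) \sum_(s in shuffles m [:: val a; m - a]%N) nested x d y a s.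
have RA : R = - f A.
  rewrite /R /A linear_sum -sumrN; apply: eq_bigr => i _.
  rewrite linear_sum -sumrN; apply: eq_bigr => j ij.
  rewrite -rcons_cons theta_rcons; last by rewrite /= size_word2 // neq_ltn ij.
  by rewrite sgnD sgn1 mulrN1 scaleNr fZ scale1r fE.
have S2D : S2 = D.
  rewrite /S2; etransitivity; first by apply: (sum_diag (p:=1) (q:=1) (m:=m)); lia.
  (* The outer index of S2 counts y and the second block, the arguments of the
     inner operation; D is indexed by the size of the first block. *)
  rewrite /D (reindex_inj rev_ord_inj); apply: eq_bigr => a _ /=.
  have am : (a <= m)%N by rewrite -ltnS.
  rewrite !subSS !add1n !subKn //=; apply: eq_bigr => s _.
  have sz := size_permw x s.
  rewrite /nested wdeg_take // take_rcons ?sz // drop_rcons ?sz //.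
  rewrite !theta_rcons ?size_takel ?size_drop ?sz //.
  by rewrite permw_pword -map_take -map_drop.
have S1B : S1 = f B.
  rewrite /S1 /B; clear -fE fZ.
  (* The term k = 1 of B has no counterpart in S1; there l = m, and the block sizes
     l, 1, 0 do not add up to m, so that the set of shuffles is empty. *)
  rewrite [in RHS]big_ltn // [X in f (X + _)]big_nat_cond.
  rewrite [X in f (X + _)]big1 ?add0r; last first.
    move=> l /andP[_ /eqP lm]; rewrite big1 // => s; have -> : l = m by lia.
    by rewrite inE /=; lia.
  case: m x d => [|p] x d; first by rewrite big_nat1 !big_geq // linear0.
  etransitivity; first by apply: (sum_diag (p:=1) (q:=2) (m:=p)); lia.
  etransitivity; last first.
    by apply: (congr1 f); symmetry; apply: (sum_diag (p:=2) (q:=0) (m:=p)); lia.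
  rewrite linear_sum [RHS](reindex_inj rev_ord_inj); apply: eq_bigr => a _ /=.
  have ap : (a <= p)%N by rewrite -ltnS.
  rewrite !subSS subKn // !add1n add0n add2n /=.
  rewrite (_ : (p - a - 0 = p.+1 - a - 1)%N); last lia.
  rewrite linear_sum; apply: eq_bigr => s _.
  have sz := size_permw x s.
  have lt : (a < p.+1)%N by lia.
  rewrite take_rcons ?sz // drop_rcons ?sz // (take_nth 0) ?sz //.
  rewrite -rcons_cons !theta_rcons ?size_takel /= ?size_drop ?sz //; try lia.
  by rewrite fZ fE.
have CD : f C = - (D + D).
  have -> : C = \sum_(a < m.+1) \sum_(s in shuffles m [:: val a; m - a]%N)
     koszul K d s *: br (T (symw (map x (take a (pword s)))))
                        (T (symw (map x (drop a (pword s))))).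
    rewrite /C; etransitivity; first by apply: (sum_diag (p:=1) (q:=0) (m:=m)); lia.
    apply: eq_bigr => a _; rewrite add1n add0n /=.
    by apply: eq_bigr => s _; rewrite permw_pword -map_take -map_drop.
  (* The second copy of D is summed over the exchanged blocks, to match the two
     terms of [act_br_nested]. *)
  rewrite opprD {2}/D -sum_shuffle_swap linear_sum -!sumrN -big_split.
  apply: eq_bigr => a _ /=.
  rewrite linear_sum -!sumrN -big_split; apply: eq_bigr => s _ /=.
  by rewrite fZ fE act_br_nested // -ltnS.
rewrite linearD fZ CD S1B S2D RA => E.
have two0 : (2 : K) != 0 by move/pcharf0P: char0 => ->.
have {}E : f A + f B = - D.
  by rewrite E -mulr2n -scaler_nat scalerN scalerA mulVf // scale1r.
by rewrite -[D]opprK -E; rewrite opprD addrCA subrr addr0.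
Qed.

End PostLie.

Theorem theorem3p11 (K : fieldType) (K_char0 : [pchar K] =i pred0)
    (g h : sgLa K) (rho : g -> h -> h) (rho_action : sgLa_action rho)
    (T : sym h -> g) (T_O_operator : homotopy_O_operator 1 rho T) :
  operator_homotopy_post_Lie (theta_of rho T).
Proof.
have T_hom := T_O_operator.1.
split.
- exact: theta_multilin.
- exact: theta_deg1.
- exact: theta_symm.
- exact: theta_der.
- exact: theta_rel.
Qed.
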